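(* Consider the regression model with standard normal error density fitted to data from $P_0$, where $Y=f_0(X)+e_0$. Let $\mathscr{F}$ be a class of uniformly bounded measurable functions $f:\mathscr{X}\to\mathbb{R}$ such that either $f_0\in\mathscr{F}$ or $\mathscr{F}$ is convex and closed in $L_2(P_0)$. Assume that $f_0$ is uniformly bounded, that $\mathrm{E}_0e_0=0$ and that $\mathrm{E}_0e^{M|e_0|}<\infty$ for every $M>0$. Let $f^*\in\mathscr{F}$ be the minimizer of $f\mapsto P_0(f-f_0)^2$ over $\mathscr{F}$, and assume in addition that $P_0(f-f^* )(f^*-f_0)=0$ for every $f\in\mathscr{F}$. If $\varepsilon_n$ is a sequence of strictly positive numbers with $\varepsilon_n\to0$ and $n\varepsilon_n^2\to\infty$ such that, for a constant $L>0$ and all $n$, $$\Pi\bigl(f\in\mathscr{F}:P_0(f-f^* )^2\le\varepsilon_n^2\bigr)\ge e^{-Ln\varepsilon_n^2},$$ $$N(\varepsilon_n,\mathscr{F},\|\cdot\|_{P_0,2})\le e^{n\varepsilon_n^2},$$ then, for every sufficiently large constant $M$, $$\Pi_n\bigl(f\in\mathscr{F}:P_0(f-f^* )^2\ge M\varepsilon_n^2\,\big|\,(X_1,Y_1),\ldots,(X_n,Y_n)\bigr)\to0\quad\text{in }L_1(P_0^n).$$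
   Context: $P_0$ is the distribution of a random vector $(X,Y)$ satisfying $Y=f_0(X)+e_0$ for independent random variables $X$ and $e_0$ with values in a measurable space $(\mathscr{X},\mathscr{A})$ and in $\mathbb{R}$, respectively, and a measurable function $f_0:\mathscr{X}\to\mathbb{R}$; the marginal distributions of $X$ and $e_0$ are fixed. $(X_1,Y_1),(X_2,Y_2),\ldots$ are i.i.d. from $P_0$, and $\mathrm{E}_0$ is expectation under $P_0$. For a function $g$ on $\mathscr{X}$, $P_0g=\mathrm{E}_0g(X)$ and $\|g\|_{P_0,2}=(P_0g^2)^{1/2}$. $N(\varepsilon,\mathscr{F},\|\cdot\|_{P_0,2})$ is the minimal number of $\|\cdot\|_{P_0,2}$-balls of radius $\varepsilon$ needed to cover $\mathscr{F}$. With $p(z)=(2\pi)^{-1/2}e^{-z^2/2}$ and $\Pi$ a prior probability measure on $\mathscr{F}$, the (misspecified) posterior is $$\Pi_n(B|(X_1,Y_1),\ldots,(X_n,Y_n))=\frac{\int_B\prod_{i=1}^np(Y_i-f(X_i))\,d\Pi(f)}{\int\prod_{i=1}^np(Y_i-f(X_i))\,d\Pi(f)}.$$ The true error $e_0$ need not be normal. The minimizer $f^*$ is unique up to $P_0$-null sets under the stated alternatives (it equals $f_0$ if $f_0\in\mathscr{F}$). Convergence in $L_1(P_0^n)$ means that the expectation under the $n$-fold product of $P_0$ converges. *)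

(* Defs.v *)
From HB Require Import structures.
From mathcomp Require Import all_boot all_order all_algebra.
From mathcomp Require Import all_classical all_reals all_analysis.

Set Implicit Arguments.
Unset Strict Implicit.
Unset Printing Implicit Defensive.

Import Order.TTheory GRing.Theory Num.Theory.
Import numFieldNormedType.Exports.

Local Open Scope classical_set_scope.
Local Open Scope ring_scope.

Definition independent_RVs (R : realType) (d d1 d2 : measure_display)
    (W : measurableType d) (T1 : measurableType d1) (T2 : measurableType d2)
    (P : probability W R) (U : {RV P >-> T1}) (V : {RV P >-> T2}) : Prop :=
  forall (A : set T1) (B : set T2), measurable A -> measurable B ->
    P ((U @^-1` A) `&` (V @^-1` B)) = (P (U @^-1` A) * P (V @^-1` B))%E.

Section product_law.
Context (R : realType) (d : measure_display) (T : measurableType d).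

Definition cons_pair (n : nat) (z : T * n.-tuple T) : n.+1.-tuple T :=
  [tuple of z.1 :: z.2].

Lemma measurable_cons_pair (n : nat) :
  measurable_fun [set: T * n.-tuple T] (@cons_pair n).
Proof. exact: measurable_cons. Qed.

HB.instance Definition _ (n : nat) :=
  isMeasurableFun.Build _ _ _ _ (@cons_pair n) (@measurable_cons_pair n).

(* The n-fold product of Q as a law on n-tuples, built one coordinate at a
   time; [product_law_rect] is its characterization on rectangles. *)
Fixpoint product_law (Q : probability T R) (n : nat) :
    probability (n.-tuple T) R :=
  match n with
  | 0 => dirac [tuple]
  | m.+1 => distribution (Q \x product_law Q m)%E (@cons_pair m)
  end.

Lemma product_law_rect (Q : probability T R) (n : nat) (A : 'I_n -> set T) :
  (forall i, measurable (A i)) ->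
  product_law Q n [set s | forall i, A i (tnth s i)] =
  (\prod_(i < n) Q (A i))%E.
Proof.
elim: n A => [|n IH] A mA.
  by rewrite big_ord0 /= diracE mem_set// => -[].
rewrite big_ord_recl -IH//= /distribution /pushforward /=.
set B := [set s : n.-tuple T | forall i, A (lift ord0 i) (tnth s i)].
have mB : measurable B.
  have -> : B = \bigcap_(i in [set: 'I_n])
      ((fun s : n.-tuple T => tnth s i) @^-1` A (lift ord0 i)).
    by apply/seteqP; split=> s /= h i => [_|]; exact: h.
  apply: fin_bigcap_measurable; first exact: finite_finset.
  by move=> i _; rewrite -[X in measurable X]setTI; exact: measurable_tnth.
rewrite -(product_measure1E Q (product_law Q n))//; congr (_ _).
apply/seteqP; split=> -[x s] /=.
  move=> h; split=> /= [|i]; first exact: (h ord0).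
  by have := h (lift ord0 i); rewrite tnthS.
move=> [/= h0 hs] i; case: (unliftP ord0 i) => [j ->|->] //.
by rewrite tnthS; exact: hs.
Qed.

End product_law.

Section regression.
Context (R : realType) (d : measure_display) (T : measurableType d).
Implicit Types (g : T -> R) (F : set (T -> R)).

(* P_0 g = E_0 g(X) *)
Definition meanX (P0 : probability (T * R)%type R) g : \bar R :=
  ('E_P0[(fun z => g z.1)%R])%E.

(* ||g||_{P_0,2} *)
Definition normX (P0 : probability (T * R)%type R) g : \bar R :=
  ('N[P0]_2%:E[(fun z => (g z.1)%:E)])%E.

(* The balls are open, and their centers are arbitrary elements of L_2(P_0);
   the value is +oo when no finite cover exists. *)
Definition covering_number (P0 : probability (T * R)%type R)
    (e : R) F : \bar R :=
  ereal_inf [set k%:R%:E | k in [set k : nat |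
    exists c : 'I_k -> T -> R,
      (forall i, measurable_fun setT (c i) /\ (normX P0 (c i) < +oo)%E) /\
      forall f, F f ->
        exists i, (normX P0 (fun x => f x - c i x)%R < e%:E)%E]].

(* The elements of L_2(P_0) are classes of functions: F is identified with
   the set of all measurable versions of its members. *)
Definition L2_versions (P0 : probability (T * R)%type R) F :
    set (T -> R) :=
  [set g | measurable_fun setT g /\
           exists2 f, F f & {ae P0, forall z, g z.1 = f z.1}].

Definition convex_in_L2 (P0 : probability (T * R)%type R) F : Prop :=
  forall (f g : T -> R) (t : R),
    L2_versions P0 F f -> L2_versions P0 F g -> 0 <= t <= 1 ->
    L2_versions P0 F (fun x => t * f x + (1 - t) * g x).

Definition closed_in_L2 (P0 : probability (T * R)%type R) F : Prop :=
  forall g : T -> R,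
    measurable_fun setT g -> (normX P0 g < +oo)%E ->
    (forall e : R, 0 < e ->
       exists2 f, F f & (normX P0 (fun x => f x - g x)%R < e%:E)%E) ->
    L2_versions P0 F g.

Definition is_risk_minimizer (P0 : probability (T * R)%type R)
    F (f0 fs : T -> R) : Prop :=
  F fs /\ forall f, F f ->
    (meanX P0 (fun x => (fs x - f0 x) ^+ 2)%R <=
     meanX P0 (fun x => (f x - f0 x) ^+ 2)%R)%E.

Definition likelihood (n : nat) (s : n.-tuple (T * R)) (f : T -> R) : R :=
  \prod_(i < n) normal_pdf 0 1 ((tnth s i).2 - f (tnth s i).1).

(* A prior on F is a probability measure on T -> R, with an arbitrary sigma
   algebra <<s G>>, for which F is measurable and has mass one. *)
Definition posterior (G : set (set (T -> R)))
    (Pi : probability (g_sigma_algebraType G) R) F (B : set (T -> R))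
    (n : nat) (s : n.-tuple (T * R)) : R :=
  (\int[Pi]_(f in B) likelihood s f) / (\int[Pi]_(f in F) likelihood s f).

End regression.

(* Main.v *)
Require Import Defs.
From HB Require Import structures.
From mathcomp Require Import all_boot all_order all_algebra.
From mathcomp Require Import all_classical all_reals all_analysis.
From mathcomp Require Import measurable_realfun ring lra.

(* Let l_f be the log-likelihood ratio of f with respect to fs and S_f its sum
   over the sample.  For f, g in F, alpha in [0, 1] and v = l_f - (1 - alpha) l_g,
   the inequality e^v <= 1 + v + v^2 e^|v|, the independence of the noise and the
   orthogonality condition bound E e^v by
     1 - |f-fs|^2/2 + (1-alpha)/2 |g-fs|^2 + kappa (|f-g|^2 + alpha^2 |g-fs|^2).
   With alpha = 0 and f = fs this controls E e^(- S_g) by e^(C n eps^2) on the prior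
   ball; with alpha small it gives E e^(S_f - (1-alpha) S_g) <= e^(- c n M eps^2)
   whenever |g-fs|^2 >= M eps^2 and |f-g| <= 2 eps.  Tests are not needed: if the
   evidence exceeds e^(-t), the posterior mass of a cell A around g is at most
     e^(alpha t) (e^(alpha S_g) + int_A e^(S_f - (1-alpha) S_g) dPi(f)),
   as one sees by distinguishing S_g >= -t (the mass is at most 1) and S_g < -t.
   If it does not, then AM-GM on the prior ball B0 gives
     1 <= e^(-t) Pi(B0)^(-2) int_B0 e^(- S_f) dPi(f).
   Both bounds are linear in exponentials of sums, so Tonelli and the product law
   reduce their expectations to the one-observation estimates. *)

Set Implicit Arguments.
Unset Strict Implicit.
Unset Printing Implicit Defensive.

Import Order.TTheory GRing.Theory Num.Theory.
Import numFieldNormedType.Exports.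

Local Open Scope classical_set_scope.
Local Open Scope ring_scope.

(** * Exponential moments *)

(** Multiplying [1 - v <= expR (- v)] by [expR v] gives [expR v - 1 <= v * expR v]. For [v >= 0]
    this is used once more inside [v * (expR v - 1)]. For [v < 0] the tangent bound
    [v <= expR v - 1], multiplied by the negative [v], gives [v * (expR v - 1) <= v ^+ 2]. *)
Lemma expR_le_quadratic (R : realType) (v : R) :
  expR v <= 1 + v + v ^+ 2 * expR `|v|.
Proof.
have e0 : 0 < expR v := expR_gt0 v.
have h1 : expR v <= 1 + v * expR v.
  have : 1 - v <= expR (- v) by apply: le_trans (expR_ge1Dx _).
  by rewrite expRN -(ler_pM2r e0) mulVf ?gt_eqF//; lra.
have [v0|v0] := leP 0 v.
  have h2 : v * (expR v - 1) <= v * (v * expR v) by apply: ler_wpM2l => //; lra.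
  by rewrite (ger0_norm v0); lra.
have h3 : 1 + v <= expR v := expR_ge1Dx v.
have h4 : v * (expR v - 1) <= v * v by rewrite ler_nM2l//; lra.
have h5 : 1 <= expR `|v| by rewrite -[leLHS]expR0 ler_expR.
have h6 : v ^+ 2 * 1 <= v ^+ 2 * expR `|v| by apply: ler_wpM2l => //; exact: sqr_ge0.
by rewrite expr2 in h6 *; lra.
Qed.

Section noise.
Context (R : realType) (nu : probability R R).
Context (nu_exp : forall M : R, 0 < M ->
  (\int[nu]_e (expR (M * `|e|))%:E < +oo)%E).
Context (nu_mean : (\int[nu]_e e%:E = 0)%E).

Let integrable_expR_abs (M : R) : 0 < M ->
  nu.-integrable setT (fun e => (expR (M * `|e|))%:E).
Proof.
move=> M0; apply/integrableP; split.
  apply/measurable_EFinP; apply: measurableT_comp => //.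
  by apply: measurable_funM => //; exact: normr_measurable.
by under eq_integral do rewrite gee0_abs ?lee_fin ?expR_ge0//; exact: nu_exp.
Qed.

Let integrable_id : nu.-integrable setT (fun e => e%:E).
Proof.
apply: (le_integrable measurableT _ _ (integrable_expR_abs ltr01)).
  exact/measurable_EFinP.
move=> e _; rewrite lee_fin mul1r [leRHS]ger0_norm ?expR_ge0//.
by apply: le_trans (expR_ge1Dx _); lra.
Qed.

(** [expR_le_quadratic] at [v = a * e + b] is integrated: the linear term contributes only [b]
    because the noise is centered, and the remainder is [delta ^+ 2] times a fixed integrable
    function of [e]. The point is that [K] depends on [c] and the noise only, so the bound is
    uniform in [a], [b] and [delta]. *)
Lemma noise_mgf_le (c : R) : 0 <= c -> exists2 K : R, 0 <= K &
  forall a b delta : R, 0 <= delta <= c ->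
    (forall e, `|a * e + b| <= delta * (`|e| + c)) ->
    (\int[nu]_e (expR (a * e + b))%:E <= (1 + b + K * delta ^+ 2)%:E)%E.
Proof.
(* With [q = |e| + c], the factor [expR |v|] costs [expR (c * q)] and the square costs
   [q ^+ 2 <= expR (2 * q)]; together they give the rate [c + 2] and the dominating function [w]. *)
move=> c0; pose m := c + 2.
pose w (e : R) := expR (m * c) * expR (m * `|e|).
have iw : nu.-integrable setT (fun e => (w e)%:E).
  have m0 : 0 < m by rewrite /m; lra.
  have := integrableZl measurableT (expR (m * c)) (integrable_expR_abs m0).
  by apply: eq_integrable => // e _.
have [K wK] : exists K : R, (\int[nu]_e (w e)%:E = K%:E)%E.
  by exists (fine (\int[nu]_e (w e)%:E)); rewrite fineK// integrable_fin_num.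
exists K.
  by rewrite -lee_fin -wK; apply: integral_ge0 => e _; rewrite lee_fin mulr_ge0 ?expR_ge0.
move=> a b delta /andP[d0 dc] H.
have ib : nu.-integrable setT (fun _ : R => (1 + b)%:E).
  exact: finite_measure_integrable_cst.
have iae : nu.-integrable setT (fun e => a%:E * e%:E)%E by exact: integrableZl.
have idw : nu.-integrable setT (fun e => (delta ^+ 2)%:E * (w e)%:E)%E.
  exact: integrableZl.
have mexp : measurable_fun setT (fun e : R => (expR (a * e + b))%:E).
  apply/measurable_EFinP; apply: measurableT_comp => //.
  by apply: measurable_funD => //; exact: measurable_funM.
have bound e : expR (a * e + b) <= 1 + b + a * e + delta ^+ 2 * w e.
  apply: le_trans (expR_le_quadratic _) _.
  have -> : 1 + (a * e + b) = 1 + b + a * e by ring.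
  rewrite lerD2l.
  set q : R := `|e| + c; have q0 : 0 <= q by rewrite addr_ge0.
  have h1 : (a * e + b) ^+ 2 <= delta ^+ 2 * q ^+ 2.
    rewrite -exprMn -[leLHS]real_normK ?num_real// lerXn2r ?nnegrE ?mulr_ge0//.
  have h2 : expR `|a * e + b| <= expR (c * q).
    by rewrite ler_expR (le_trans (H e))// ler_wpM2r.
  have h3 : q ^+ 2 <= expR (2 * q).
    rewrite [expR _](_ : _ = expR q ^+ 2); last first.
      by rewrite -expRM_natl.
    rewrite ler_sqr ?nnegrE ?expR_ge0//.
    by apply: le_trans (expR_ge1Dx q); lra.
  have -> : w e = expR (2 * q) * expR (c * q).
    by rewrite /w -!expRD /q /m; congr expR; ring.
  rewrite mulrA; apply: ler_pM => //; rewrite ?sqr_ge0 ?expR_ge0//.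
  by apply: (le_trans h1); rewrite ler_wpM2l ?sqr_ge0.
apply: (@le_trans _ _
    (\int[nu]_e ((1 + b)%:E + a%:E * e%:E + (delta ^+ 2)%:E * (w e)%:E))%E).
  apply: ge0_le_integral => //.
  - apply: emeasurable_funD; last exact: (measurable_int nu idw).
    by apply: emeasurable_funD => //; exact: (measurable_int nu iae).
  - by move=> e _; rewrite -!EFinM -!EFinD lee_fin.
rewrite (integralD measurableT (integrableD measurableT ib iae) idw).
rewrite (integralD measurableT ib iae) !integralZl// nu_mean mule0 adde0.
have -> : (\int[nu]_e (1 + b)%:E = (1 + b)%:E)%E.
  by rewrite (integral_cst nu measurableT) [X in (_ * X)%E](probability_setT nu) mule1.
by rewrite wK -EFinM -EFinD lee_fin [_ * delta ^+ 2]mulrC.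
Qed.

End noise.

(** * Integration under the product law *)

Section product_law_integral.
Context (R : realType) (d : measure_display) (T : measurableType d).

Lemma measurable_prod_tnth (g : T -> R) (n : nat) : measurable_fun setT g ->
  measurable_fun setT (fun s : n.-tuple T => \prod_(i < n) g (tnth s i)).
Proof.
move=> mg; apply: measurable_prod => i _.
by apply: measurableT_comp => //; exact: measurable_tnth.
Qed.

(** By Tonelli the first coordinate splits off from the remaining tuple, so each observation
    contributes one factor [m]. This turns a one-observation moment bound into one for the whole
    sample. *)
Lemma integral_product_law_prod_le (Q : probability T R) (g : T -> R) (m : R)
    (n : nat) :
  measurable_fun setT g -> (forall x, 0 <= g x) ->
  (\int[Q]_x (g x)%:E <= m%:E)%E ->
  (\int[product_law Q n]_s (\prod_(i < n) g (tnth s i))%:E <= (m ^+ n)%:E)%E.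
Proof.
move=> mg g0 gm.
have m0 : 0 <= m.
  by rewrite -lee_fin (le_trans _ gm)//; apply: integral_ge0 => x _; rewrite lee_fin.
have prod0 k (s : k.-tuple T) : 0 <= \prod_(i < k) g (tnth s i).
  exact: prodr_ge0.
elim: n => [|n IH].
  rewrite (eq_integral (cst 1%E)); last by move=> s _; rewrite big_ord0.
  rewrite (integral_cst (product_law Q 0) measurableT).
  by rewrite [X in (_ * X)%E](probability_setT (product_law Q 0)) mule1.
have mp k : measurable_fun setT (fun s : k.-tuple T => (\prod_(i < k) g (tnth s i))%:E).
  by apply/measurable_EFinP; exact: measurable_prod_tnth.
rewrite /= (ge0_integral_distribution _ (mp n.+1)); last by move=> s; rewrite lee_fin; exact: prod0.
rewrite (eq_integral (fun z : T * n.-tuple T =>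
    (g z.1 * \prod_(i < n) g (tnth z.2 i))%:E)); last first.
  move=> z _ /=; rewrite big_ord_recl tnth0; congr (_ * _)%:E.
  by apply: eq_bigr => i _; rewrite tnthS.
have mh : measurable_fun setT (fun z : T * n.-tuple T =>
    (g z.1 * \prod_(i < n) g (tnth z.2 i))%:E).
  apply/measurable_EFinP; apply: measurable_funM.
    exact: measurableT_comp.
  exact: (measurableT_comp (measurable_prod_tnth (n := n) mg) measurable_snd).
have h0 (z : T * n.-tuple T) : 0 <= g z.1 * \prod_(i < n) g (tnth z.2 i).
  by apply: mulr_ge0 => //; exact: prod0.
rewrite fubini_tonelli1//.
apply: (@le_trans _ _ (\int[Q]_x ((m ^+ n)%:E * (g x)%:E))%E).
  apply: ge0_le_integral => //.
  - by move=> x _; apply: integral_ge0 => s _; rewrite lee_fin (h0 (x, s)).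
  - by apply: measurable_fun_fubini_tonelli_F => // z; rewrite lee_fin.
  - by apply: emeasurable_funM => //; exact/measurable_EFinP.
  - move=> x _; rewrite /fubini_F /=.
    under eq_integral do rewrite EFinM.
    rewrite (ge0_integralZl _ measurableT (mp n)) ?lee_fin//.
      by rewrite muleC lee_wpmul2r// lee_fin.
    by move=> s _; rewrite lee_fin; exact: prod0.
have mgE : measurable_fun setT (fun x => (g x)%:E) by exact/measurable_EFinP.
rewrite (ge0_integralZl _ measurableT mgE); first last.
- by rewrite lee_fin exprn_ge0.
- by move=> x _; rewrite lee_fin.
by rewrite exprSr EFinM lee_wpmul2l// lee_fin exprn_ge0.
Qed.

End product_law_integral.

(** * The law of one observation *)

Section regression_law.
Context (R : realType) (dW dT : measure_display) (W : measurableType dW)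
  (T : measurableType dT) (P : probability W R).
Context (X : {RV P >-> T}) (e0 : {RV P >-> R}) (XY : {RV P >-> (T * R)%type}).
Context (f0 : T -> R) (mf0 : measurable_fun setT f0).
Context (indep : independent_RVs X e0).
Context (XYE : forall w, XY w = (X w, f0 (X w) + e0 w)).

(** Independence identifies the law of [(X, e0)] with the product of its marginals, by uniqueness of
    the product measure. The observation is the image of this pair under [(x, e) |-> (x, f0 x + e)],
    and Tonelli gives the iterated integral. *)
Lemma integral_regression_law (H : T * R -> \bar R) :
  measurable_fun setT H -> (forall z, 0 <= H z)%E ->
  (\int[distribution P XY]_z H z =
   \int[distribution P X]_x \int[distribution P e0]_e H (x, (f0 x + e)%R))%E.
Proof.
move=> mH H0; pose J w := (X w, e0 w).
have mJ : measurable_fun setT J by exact: measurable_fun_pair.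
pose J' : {RV P >-> (T * R)%type} := HB.pack J (isMeasurableFun.Build _ _ _ _ J mJ).
pose H' (z : T * R) := H (z.1, f0 z.1 + z.2).
have mH' : measurable_fun setT H'.
  apply: measurableT_comp => //; apply: measurable_fun_pair => //.
  by apply: measurable_funD => //; exact: measurableT_comp.
transitivity (\int[distribution P J']_z H' z)%E.
  rewrite (ge0_integral_distribution _ mH H0).
  rewrite (ge0_integral_distribution _ mH' (fun z => H0 _)); apply: eq_integral => w _ /=.
  by rewrite XYE.
transitivity (\int[distribution P X \x distribution P e0]_z H' z)%E.
  apply: eq_measure_integral => A mA _; apply/esym.
  exact: product_measure_unique.
exact: fubini_tonelli1 mH' (fun z => H0 _).
Qed.

End regression_law.

(** * Squared distances and log-likelihood ratios *)

Section bounded_integrals.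
Context (R : realType) (d : measure_display) (T : measurableType d)
  (mu : probability T R).

(** Real-valued so that linear arithmetic applies; for bounded measurable functions [EFin_sqdist]
    identifies it with the extended-real integral. *)
Definition sqdist (f g : T -> R) : R := \int[mu]_x ((f x - g x) ^+ 2).

Lemma bounded_integrable (f : T -> R) (k : R) : measurable_fun setT f ->
  (forall x, `|f x| <= k) -> mu.-integrable setT (EFin \o f).
Proof.
move=> mf fk; apply: measurable_bounded_integrable => //.
  by rewrite [X in (X < _)%E](probability_setT mu) ltry.
by exists k; split; [exact: num_real | move=> y ky x _; exact/(le_trans (fk x))/ltW].
Qed.

Lemma EFin_Rintegral (f : T -> R) : mu.-integrable setT (EFin \o f) ->
  (\int[mu]_x (f x)%:E = (\int[mu]_x f x)%:E)%E.
Proof. by move=> intf; rewrite /Rintegral fineK// integrable_fin_num. Qed.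

Lemma sqdist_integrable (f g : T -> R) (k : R) :
  measurable_fun setT f -> measurable_fun setT g ->
  (forall x, `|f x| <= k) -> (forall x, `|g x| <= k) ->
  mu.-integrable setT (EFin \o (fun x => (f x - g x) ^+ 2)).
Proof.
move=> mf mg fk gk; apply: (@bounded_integrable _ ((k + k) ^+ 2)).
  by apply: measurable_funX; exact: measurable_funB.
move=> x; rewrite normrX lerXn2r ?nnegrE//.
  by rewrite addr_ge0//; apply: le_trans (fk x).
by apply: le_trans (ler_normB _ _) _; exact: lerD.
Qed.

Lemma EFin_sqdist (f g : T -> R) (k : R) :
  measurable_fun setT f -> measurable_fun setT g ->
  (forall x, `|f x| <= k) -> (forall x, `|g x| <= k) ->
  (\int[mu]_x ((f x - g x) ^+ 2)%:E = (sqdist f g)%:E)%E.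
Proof. by move=> mf mg fk gk; apply: EFin_Rintegral; exact: sqdist_integrable fk gk. Qed.

Lemma sqdist_ge0 (f g : T -> R) : 0 <= sqdist f g.
Proof. by apply: Rintegral_ge0 => x _; exact: sqr_ge0. Qed.

Lemma sqdist_xx (f : T -> R) : sqdist f f = 0.
Proof.
rewrite /sqdist (@eq_Rintegral _ _ _ _ _ (cst 0)); last by move=> x _; rewrite subrr expr0n.
by rewrite Rintegral_cst// mul0r.
Qed.

Lemma sqdistC (f g : T -> R) : sqdist f g = sqdist g f.
Proof. by apply: eq_Rintegral => x _; rewrite -sqrrN opprB. Qed.

End bounded_integrals.

Section log_likelihood_ratio.
Context (R : realType) (T : Type).

(** The logarithm of the ratio of the normal densities centered at [f] and at [fs]: with
    [h = f - fs] and residual [r = y - fs], it is [(r ^+ 2 - (r - h) ^+ 2) / 2 = h * r - h ^+ 2 /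
    2]. *)
Definition llr (fs f : T -> R) (z : T * R) : R :=
  (f z.1 - fs z.1) * (z.2 - fs z.1) - (f z.1 - fs z.1) ^+ 2 / 2.

Lemma llr_xx (fs : T -> R) z : llr fs fs z = 0.
Proof. by rewrite /llr subrr mul0r expr0n mul0r subrr. Qed.

Lemma normal_pdf_llr (fs f : T -> R) (z : T * R) :
  normal_pdf 0 1 (z.2 - f z.1) =
  normal_pdf 0 1 (z.2 - fs z.1) * expR (llr fs f z).
Proof.
rewrite !normal_pdfE ?oner_eq0// -mulrA /normal_fun -expRD; congr (_ * expR _).
by rewrite /llr; field.
Qed.

End log_likelihood_ratio.

Lemma measurable_llr (R : realType) (d : measure_display) (T : measurableType d)
    (fs f : T -> R) :
  measurable_fun setT fs -> measurable_fun setT f ->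
  measurable_fun setT (llr fs f).
Proof.
move=> mfs mf.
have m1 : measurable_fun setT (fun z : T * R => f z.1 - fs z.1).
  by apply: measurable_funB; exact: measurableT_comp.
have m2 : measurable_fun setT (fun z : T * R => z.2 - fs z.1).
  by apply: measurable_funB => //; exact: measurableT_comp.
apply: measurable_funB; first exact: measurable_funM.
by apply: measurable_funM => //; exact: measurable_funX.
Qed.

(** * Exponential moments of log-likelihood ratios *)

Section llr_mgf.
Context (R : realType) (d : measure_display) (T : measurableType d)
  (mu : probability T R) (nu : probability R R)
  (P0 : probability (T * R)%type R).
Context (f0 fs : T -> R) (c : R).
Context (c0 : 0 <= c) (mf0 : measurable_fun setT f0) (mfs : measurable_fun setT fs).
Context (f0c : forall x, `|f0 x| <= c) (fsc : forall x, `|fs x| <= c).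
Context (P0E : forall H : T * R -> \bar R,
  measurable_fun setT H -> (forall z, 0 <= H z)%E ->
  (\int[P0]_z H z = \int[mu]_x \int[nu]_e H (x, (f0 x + e)%R))%E).
Context (nu_exp : forall M : R, 0 < M ->
  (\int[nu]_e (expR (M * `|e|))%:E < +oo)%E).
Context (nu_mean : (\int[nu]_e e%:E = 0)%E).

Definition regular_regressor (f : T -> R) : Prop :=
  [/\ measurable_fun setT f, forall x, `|f x| <= c &
      (\int[mu]_x ((f x - fs x) * (fs x - f0 x)) = 0)].

(** Given the design point [x], the exponent is affine in the noise, so [noise_mgf_le] bounds the
    inner integral by [1 + b x + K * delta x ^+ 2]. Integrating over [x], the cross terms of [b]
    with [f0 - fs] vanish by orthogonality, and only squared distances remain. *)
Lemma llr_mgf_le : exists2 kappa : R, 0 < kappa &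
  forall (f f1 : T -> R) (alpha : R), regular_regressor f -> regular_regressor f1 ->
    0 <= alpha <= 1 ->
    (\int[P0]_z (expR (llr fs f z - (1 - alpha) * llr fs f1 z))%:E <=
     (1 - sqdist mu f fs / 2 + (1 - alpha) / 2 * sqdist mu f1 fs +
      kappa * (sqdist mu f f1 + alpha ^+ 2 * sqdist mu f1 fs))%:E)%E.
Proof.
(* The constant [6 * c] bounds [delta]: at most [4 * c] from [h - h1] and [2 * c] from [alpha * h1].
   It also exceeds the [4 * c] that the noise-free part [b] requires in [vle]. *)
have c_ge0 := c0; have c6 : 0 <= 6 * c by lra.
have [K K0 HK] := noise_mgf_le nu_exp nu_mean c6.
(* The [2 * K] comes from squaring the two-term sum [delta]; the [1] makes [kappa] strictly
   positive. *)
exists (2 * K + 1); first lra.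
move=> f f1 alpha [mf fc fo] [mf1 f1c f1o] /andP[a0 a1].
pose h x : R := f x - fs x; pose h1 x := f1 x - fs x.
pose b x : R := (h x - (1 - alpha) * h1 x) * (f0 x - fs x)
            - h x ^+ 2 / 2 + (1 - alpha) * h1 x ^+ 2 / 2.
pose delta x : R := `|h x - h1 x| + alpha * `|h1 x|.
have vE x e : llr fs f (x, f0 x + e) - (1 - alpha) * llr fs f1 (x, f0 x + e) =
    (h x - (1 - alpha) * h1 x) * e + b x.
  by rewrite /llr /b /h /h1 /=; field.
have hc x : `|h x| <= 2 * c.
  by apply: le_trans (ler_normB _ _) _; have := fc x; have := fsc x; lra.
have h1c x : `|h1 x| <= 2 * c.
  by apply: le_trans (ler_normB _ _) _; have := f1c x; have := fsc x; lra.
have f0s x : `|f0 x - fs x| <= 2 * c.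
  by apply: le_trans (ler_normB _ _) _; have := f0c x; have := fsc x; lra.
have hh1c x : `|h x - h1 x| <= 4 * c.
  by apply: le_trans (ler_normB _ _) _; have := hc x; have := h1c x; lra.
have delta_ge0 x : 0 <= delta x by rewrite addr_ge0// mulr_ge0.
have delta_le x : delta x <= 6 * c.
  have : alpha * `|h1 x| <= 1 * `|h1 x| by exact: ler_wpM2r.
  by have := hh1c x; have := h1c x; rewrite /delta; lra.
have vle x e : `|(h x - (1 - alpha) * h1 x) * e + b x| <=
    delta x * (`|e| + 6 * c).
  have n1 : `|h x - (1 - alpha) * h1 x| <= delta x.
    rewrite [X in `|X|](_ : _ = (h x - h1 x) + alpha * h1 x); last by ring.
    by apply: le_trans (ler_normD _ _) _; rewrite normrM (ger0_norm a0).
  (* The quadratic part is also of first order in [delta], since it factors as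
     [(h - h1) * (h + h1) + alpha * h1 * h1]. *)
  have n2 : `|h x ^+ 2 - (1 - alpha) * h1 x ^+ 2| <= delta x * (4 * c).
    rewrite [X in `|X|](_ : _ =
      (h x - h1 x) * (h x + h1 x) + (alpha * h1 x) * h1 x); last by ring.
    apply: le_trans (ler_normD _ _) _; rewrite !normrM (ger0_norm a0) mulrDl.
    apply: lerD; apply: ler_wpM2l; rewrite ?mulr_ge0//.
      by apply: le_trans (ler_normD _ _) _; have := hc x; have := h1c x; lra.
    by have := h1c x; have := normr_ge0 (h1 x); lra.
  have -> : (h x - (1 - alpha) * h1 x) * e + b x =
     (h x - (1 - alpha) * h1 x) * e + (h x - (1 - alpha) * h1 x) * (f0 x - fs x)
     - (h x ^+ 2 - (1 - alpha) * h1 x ^+ 2) / 2 by rewrite /b; field.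
  apply: le_trans (ler_normB _ _) _; apply: le_trans (lerD (ler_normD _ _) (lexx _)) _.
  rewrite !normrM [`|2^-1|]ger0_norm ?invr_ge0//.
  have p1 := ler_wpM2r (normr_ge0 e) n1.
  have p2 := ler_pM (normr_ge0 _) (normr_ge0 _) n1 (f0s x).
  have p3 := mulr_ge0 (delta_ge0 x) c_ge0.
  by lra.
have mh : measurable_fun setT h by exact: measurable_funB.
have mh1 : measurable_fun setT h1 by exact: measurable_funB.
have mexp : measurable_fun setT (fun z : T * R =>
    (expR (llr fs f z - (1 - alpha) * llr fs f1 z))%:E).
  apply/measurable_EFinP; apply: measurableT_comp => //.
  apply: measurable_funB; first exact: measurable_llr.
  by apply: measurable_funM => //; exact: measurable_llr.
rewrite P0E//.
pose g1 x : R := h x * (fs x - f0 x); pose g2 x := h1 x * (fs x - f0 x).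
have ig1 : mu.-integrable setT (EFin \o g1).
  apply: (@bounded_integrable _ _ _ _ _ ((2 * c) * (2 * c))).
    by apply: measurable_funM => //; exact: measurable_funB.
  by move=> x; rewrite normrM; apply: ler_pM => //; rewrite distrC.
have ig2 : mu.-integrable setT (EFin \o g2).
  apply: (@bounded_integrable _ _ _ _ _ ((2 * c) * (2 * c))).
    by apply: measurable_funM => //; exact: measurable_funB.
  by move=> x; rewrite normrM; apply: ler_pM => //; rewrite distrC.
have is1 := sqdist_integrable mu mf mfs fc fsc.
have is2 := sqdist_integrable mu mf1 mfs f1c fsc.
have is3 := sqdist_integrable mu mf mf1 fc f1c.
have DI (u v : T -> R) : mu.-integrable setT (EFin \o u) ->
    mu.-integrable setT (EFin \o v) ->
    mu.-integrable setT (EFin \o (fun x => u x + v x)).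
  by move=> iu iv; exact: (integrableD measurableT iu iv).
have ZI (r : R) (u : T -> R) : mu.-integrable setT (EFin \o u) ->
    mu.-integrable setT (EFin \o (fun x => r * u x)).
  by move=> iu; exact: (integrableZl measurableT r iu).
(* [G] majorizes [1 + b + K * delta ^+ 2]. It is built as a right-nested sum so that its integral
   splits off one term at a time. *)
pose G6 x : R := 2 * K * alpha ^+ 2 * h1 x ^+ 2.
pose G5 x : R := 2 * K * (f x - f1 x) ^+ 2 + G6 x.
pose G4 x : R := (1 - alpha) / 2 * h1 x ^+ 2 + G5 x.
pose G3 x : R := - (1 / 2) * h x ^+ 2 + G4 x.
pose G2 x : R := (1 - alpha) * g2 x + G3 x.
pose G1 x : R := -1 * g1 x + G2 x.
pose G x : R := 1 + G1 x.
have i6 : mu.-integrable setT (EFin \o G6) by exact: ZI.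
have i5 : mu.-integrable setT (EFin \o G5) by apply: DI => //; exact: ZI.
have i4 : mu.-integrable setT (EFin \o G4) by apply: DI => //; exact: ZI.
have i3 : mu.-integrable setT (EFin \o G3) by apply: DI => //; exact: ZI.
have i2 : mu.-integrable setT (EFin \o G2) by apply: DI => //; exact: ZI.
have i1 : mu.-integrable setT (EFin \o G1) by apply: DI => //; exact: ZI.
have ic : mu.-integrable setT (EFin \o (fun _ => 1 : R)).
  exact: finite_measure_integrable_cst.
have iG : mu.-integrable setT (EFin \o G) by exact: DI.
apply: (@le_trans _ _ (\int[mu]_x (G x)%:E)%E).
  apply: ge0_le_integral => //.
  - by move=> x _; apply: integral_ge0 => e _; rewrite lee_fin expR_ge0.
  - have mJ : measurable_fun setT (fun z : T * R => (z.1, f0 z.1 + z.2)).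
      apply: measurable_fun_pair => //.
      by apply: measurable_funD => //; exact: measurableT_comp.
    have := measurableT_comp mexp mJ.
    move=> /(@measurable_fun_fubini_tonelli_F _ _ _ _ _ nu); apply=> z.
    by rewrite lee_fin expR_ge0.
  - exact: (measurable_int mu iG).
  - move=> x _; under eq_integral do rewrite vE.
    apply: (le_trans (HK _ _ (delta x) _ (vle x))); first by rewrite delta_ge0 delta_le.
    rewrite lee_fin.
    have hhE : f x - f1 x = h x - h1 x by rewrite /h /h1; ring.
    have : delta x ^+ 2 <= 2 * (h x - h1 x) ^+ 2 + 2 * alpha ^+ 2 * h1 x ^+ 2.
      rewrite -(real_normK (num_real (h x - h1 x))) -(real_normK (num_real (h1 x))).
      rewrite /delta; have := sqr_ge0 (`|h x - h1 x| - alpha * `|h1 x|).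
      by rewrite !expr2; lra.
    move=> /(ler_wpM2l K0).
    rewrite /b /G /G1 /G2 /G3 /G4 /G5 /G6 /g1 /g2 hhE; lra.
rewrite EFin_Rintegral// lee_fin.
rewrite /G (RintegralD _ ic i1)// {1}/G1 (RintegralD _ (ZI _ _ ig1) i2)//.
rewrite {1}/G2 (RintegralD _ (ZI _ _ ig2) i3)// {1}/G3 (RintegralD _ (ZI _ _ is1) i4)//.
rewrite {1}/G4 (RintegralD _ (ZI _ _ is2) i5)// {1}/G5 (RintegralD _ (ZI _ _ is3) i6)//.
rewrite /G6 !RintegralZl// fo f1o.
rewrite Rintegral_cst// [X in fine X](probability_setT mu) -!/(sqdist _ _ _) /=.
have := sqdist_ge0 mu f f1; have := mulr_ge0 (sqr_ge0 alpha) (sqdist_ge0 mu f1 fs).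
lra.
Qed.

End llr_mgf.

(** * The expected posterior mass *)

Section posterior_bound.
Context (R : realType) (d : measure_display) (Th : measurableType d)
  (Pi : probability Th R).

(** A linearized Cauchy-Schwarz inequality: [2 <= x + x^-1] with [x = l * expR (S f)] is integrated
    over [A]. The event of small evidence is thereby dominated by an integral of exponentials, whose
    expectation can be computed. *)
Lemma evidence_lower_bound (A : set Th) (S : Th -> R) (p tau : R) :
  measurable A -> measurable_fun A S -> Pi A = p%:E -> 0 < p -> 0 < tau ->
  (\int[Pi]_(f in A) (expR (S f))%:E < tau%:E)%E ->
  (1 <= (tau / p ^+ 2)%:E * \int[Pi]_(f in A) (expR (- S f))%:E)%E.
Proof.
move=> mA mS pE p0 tau0.
(* With this weight the term in [expR (S f)] is at most [p], half of the total [2 * p], so the term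
   in [expR (- S f)] carries at least the other half. *)
pose l := p / tau; have l0 : 0 < l by exact: divr_gt0.
have mE : measurable_fun A (fun f => (expR (S f))%:E).
  by apply/measurable_EFinP; exact: measurableT_comp.
have mEN : measurable_fun A (fun f => (expR (- S f))%:E).
  apply/measurable_EFinP; apply: measurableT_comp => //.
  exact: measurableT_comp.
have eI : (0 <= \int[Pi]_(f in A) (expR (S f))%:E)%E.
  by apply: integral_ge0 => f _; rewrite lee_fin expR_ge0.
have eJ : (0 <= \int[Pi]_(f in A) (expR (- S f))%:E)%E.
  by apply: integral_ge0 => f _; rewrite lee_fin expR_ge0.
have amgm : (\int[Pi]_(f in A) (2%:E) <=
    l%:E * \int[Pi]_(f in A) (expR (S f))%:E +
    (l^-1)%:E * \int[Pi]_(f in A) (expR (- S f))%:E)%E.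
  have l0' : (0 <= l^-1%:E)%E by rewrite lee_fin invr_ge0 ltW.
  have l0'' : (0 <= l%:E)%E by rewrite lee_fin ltW.
  rewrite -!ge0_integralZl//; do ?by move=> f _; rewrite lee_fin expR_ge0.
  rewrite -ge0_integralD//; first last.
  - exact: measurable_funeM.
  - by move=> f _; rewrite -EFinM lee_fin mulr_ge0 ?expR_ge0 ?invr_ge0 ?ltW.
  - exact: measurable_funeM.
  - by move=> f _; rewrite -EFinM lee_fin mulr_ge0 ?expR_ge0 ?ltW.
  apply: ge0_le_integral => //.
  - by apply: emeasurable_funD; exact: measurable_funeM.
  - move=> f _; rewrite -!EFinM -EFinD lee_fin expRN -invfM.
    have x0 : 0 < l * expR (S f) by rewrite mulr_gt0 ?expR_gt0.
    move: (l * expR (S f)) x0 => x x0.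
    rewrite -(ler_pM2r x0) [leRHS]mulrDl mulVf ?gt_eqF//.
    by have := sqr_ge0 (x - 1); rewrite expr2; lra.
rewrite (integral_cst Pi mA) [X in (_ * X <= _)%E]pE -EFinM in amgm.
move: eI eJ amgm.
case: (\int[Pi]_(f in A) (expR (S f))%:E)%E => [i||]//=.
case: (\int[Pi]_(f in A) (expR (- S f))%:E)%E => [j||]//=; last first.
  by move=> *; rewrite gt0_muley ?leey// lte_fin divr_gt0 ?exprn_gt0.
rewrite !lee_fin lte_fin => i0 j0 h itau.
have li : l * i <= p.
  by rewrite -[leRHS](@divfK _ tau) ?gt_eqF// -/l ler_wpM2l// ltW.
have pj : p <= l^-1 * j by lra.
rewrite [X in X * _](_ : _ = l^-1 / p); last first.
  by rewrite /l; field; rewrite !gt_eqF.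
by rewrite mulrAC ler_pdivlMr// mul1r.
Qed.

(** If [t + s1 >= 0], the first summand alone is at least [1 >= Z / D]. Otherwise [D^-1 <= expR t],
    and [(1 - alpha) * (t + s1) <= 0] says [t <= alpha * t - (1 - alpha) * s1], which yields the
    second summand. *)
Lemma cell_le (A : set Th) (S : Th -> R) (Z D s1 t alpha : R) :
  measurable A -> measurable_fun A S ->
  (\int[Pi]_(f in A) (expR (S f))%:E = Z%:E)%E -> Z <= D -> expR (- t) <= D ->
  0 <= alpha <= 1 ->
  ((Z / D)%:E <= (expR (alpha * t))%:E * ((expR (alpha * s1))%:E +
    \int[Pi]_(f in A) (expR (S f - (1 - alpha) * s1))%:E))%E.
Proof.
move=> mA mS ZE ZD tD /andP[a0 a1].
have D0 : 0 < D by exact: lt_le_trans (expR_gt0 _) tD.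
have mE : measurable_fun A (fun f => (expR (S f))%:E).
  by apply/measurable_EFinP; exact: measurableT_comp.
have Z0 : 0 <= Z.
  by rewrite -lee_fin -ZE; apply: integral_ge0 => f _; rewrite lee_fin expR_ge0.
under eq_integral do rewrite expRD mulrC EFinM.
rewrite (ge0_integralZl _ mA mE) ?lee_fin ?expR_ge0//.
rewrite ZE lee_fin mulrDr -expRD mulrA -expRD.
have [ts|st] := leP 0 (t + s1).
  apply: (@le_trans _ _ 1); first by rewrite ler_pdivrMr// mul1r.
  rewrite -[leLHS]addr0; apply: lerD; last by rewrite mulr_ge0 ?expR_ge0.
  by rewrite -mulrDr -[leLHS]expR0 ler_expR mulr_ge0.
rewrite -[leLHS]add0r; apply: lerD; first exact: expR_ge0.
rewrite mulrC; apply: ler_wpM2r => //.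
apply: (@le_trans _ _ (expR t)).
  by rewrite -[expR t]invrK -expRN lef_pV2 ?posrE ?expR_gt0.
rewrite ler_expR.
have : (1 - alpha) * (t + s1) <= 0 by rewrite mulr_ge0_le0 ?subr_ge0// ltW.
by lra.
Qed.

Lemma ge0_integral_cover (I : eqType) (J : seq I) (B : set Th) (A : I -> set Th)
    (f : Th -> \bar R) :
  measurable B -> (forall j, measurable (A j)) ->
  measurable_fun B f -> (forall j, measurable_fun (A j) f) ->
  (forall x, 0 <= f x)%E ->
  (forall x, B x -> exists2 j, j \in J & A j x) ->
  (\int[Pi]_(x in B) f x <= \sum_(j <- J) \int[Pi]_(x in A j) f x)%E.
Proof.
move=> mB mA mfB mfA f0 BA.
rewrite integral_mkcond.
rewrite (eq_bigr (fun j => \int[Pi]_x (f \_ (A j)) x)%E); last first.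
  by move=> j _; exact: integral_mkcond.
have fA0 j x : (0 <= (f \_ (A j)) x)%E by exact: erestrict_ge0.
have mfAT j : measurable_fun setT (f \_ (A j)) by apply/(measurable_restrictT _ _).1.
rewrite -ge0_integral_sum//.
apply: ge0_le_integral => //.
- by move=> x _; exact: erestrict_ge0.
- exact/(measurable_restrictT _ _).1.
- exact: emeasurable_sum.
move=> x _; rewrite patchE; case: ifPn => [/set_mem /BA[j jJ Ajx]|_]; last first.
  exact: sume_ge0.
rewrite (big_rem j)//= patchE mem_set// leeDl//.
exact: sume_ge0.
Qed.

Lemma posterior_le (I : eqType) (J : seq I) (F B B0 : set Th) (A : I -> set Th)
    (S : Th -> R) (s : I -> R) (p t alpha : R) :
  measurable F -> measurable B -> measurable B0 ->
  (forall j, measurable (A j)) ->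
  B `<=` F -> B0 `<=` F -> (forall j, A j `<=` F) ->
  (forall f, B f -> exists2 j, j \in J & A j f) ->
  measurable_fun F S -> Pi.-integrable F (fun f => (expR (S f))%:E) ->
  Pi B0 = p%:E -> 0 < p -> 0 <= alpha <= 1 ->
  (((\int[Pi]_(f in B) expR (S f)) / (\int[Pi]_(f in F) expR (S f)))%:E <=
   (expR (- t) / p ^+ 2)%:E * \int[Pi]_(f in B0) (expR (- S f))%:E +
   \sum_(j <- J) (expR (alpha * t))%:E * ((expR (alpha * s j))%:E +
     \int[Pi]_(f in A j) (expR (S f - (1 - alpha) * s j))%:E))%E.
Proof.
move=> mF mB mB0 mA BF B0F AF BA mS iS pE p0 a01.
have mE : measurable_fun F (fun f => (expR (S f))%:E) by exact: measurable_int iS.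
have e0 f : (0 <= (expR (S f))%:E)%E by rewrite lee_fin expR_ge0.
have RE C : measurable C -> C `<=` F ->
    (\int[Pi]_(f in C) (expR (S f))%:E = (\int[Pi]_(f in C) expR (S f))%:E)%E.
  move=> mC CF; rewrite /Rintegral fineK//; apply: integrable_fin_num => //.
  exact: integrableS iS.
have leF C : measurable C -> C `<=` F ->
    \int[Pi]_(f in C) expR (S f) <= \int[Pi]_(f in F) expR (S f).
  move=> mC CF; rewrite -lee_fin -!RE//.
  exact: ge0_subset_integral.
have sum_ge0 : (0 <= \sum_(j <- J) (expR (alpha * t))%:E *
    ((expR (alpha * s j))%:E +
     \int[Pi]_(f in A j) (expR (S f - (1 - alpha) * s j))%:E))%E.
  apply: sume_ge0 => j _; apply: mule_ge0; first by rewrite lee_fin expR_ge0.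
  apply: adde_ge0; first by rewrite lee_fin expR_ge0.
  by apply: integral_ge0 => f _; rewrite lee_fin expR_ge0.
have int_ge0 C : 0 <= \int[Pi]_(f in C) expR (S f).
  by apply: Rintegral_ge0 => f _; exact: expR_ge0.
set D := \int[Pi]_(f in F) expR (S f).
(* Each case is bounded by one of the two nonnegative summands; adding the other gives a bound with
   no case distinction left, ready to be integrated over the sample. *)
have [Dt|tD] := ltP D (expR (- t)).
  apply: (@le_trans _ _ 1%E).
    rewrite lee_fin; have [D0|D0] := ltP 0 D.
      by rewrite ler_pdivrMr// mul1r leF.
    (* Division by zero returns zero, so the ratio is at most one here too. *)
    have -> : D = 0 by apply/eqP; rewrite eq_le D0 int_ge0.
    by rewrite invr0 mulr0.
  rewrite -[leLHS]adde0; apply: leeD => //.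
  apply: evidence_lower_bound => //; [exact: measurable_funS mS|exact: expR_gt0|].
  by rewrite RE// lte_fin (le_lt_trans _ Dt)// leF.
have D0 : 0 < D by exact: lt_le_trans (expR_gt0 _) tD.
apply: (@le_trans _ _ (\sum_(j <- J) ((\int[Pi]_(f in A j) expR (S f)) / D)%:E)%E).
  rewrite sumEFin lee_fin -mulr_suml ler_pM2r ?invr_gt0//.
  rewrite -lee_fin -sumEFin -RE//; under eq_bigr do rewrite -RE//.
  apply: ge0_integral_cover => //; first exact: measurable_funS mE.
  by move=> j; exact: measurable_funS mE.
rewrite -[leLHS]add0e; apply: leeD.
  apply: mule_ge0; first by rewrite lee_fin divr_ge0 ?expR_ge0 ?exprn_ge0 ?ltW.
  by apply: integral_ge0 => f _; rewrite lee_fin expR_ge0.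
apply: lee_sum => j _; apply: cell_le => //.
- exact: measurable_funS mS.
- exact: RE.
- exact: leF.
Qed.

End posterior_bound.

(** The integral of a nonnegative function is a supremum over the simple functions below it, so
    monotonicity holds without measurability. It is applied to the posterior mass as a function of
    the sample. *)
Lemma le_ge0_integral (R : realType) (d : measure_display) (T : measurableType d)
    (mu : {measure set T -> \bar R}) (f g : T -> \bar R) :
  (forall x, 0 <= f x)%E -> (forall x, f x <= g x)%E ->
  (\int[mu]_x f x <= \int[mu]_x g x)%E.
Proof.
move=> f0 fg; have g0 x : (0 <= g x)%E := le_trans (f0 x) (fg x).
rewrite !ge0_integralTE//; apply: le_ereal_sup => _ [h hf <-].
by exists h => // x; apply: le_trans (hf x) (fg x).
Qed.

(** * Averaging over prior and sample *)

Section mixture.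
Context (R : realType) (d dT : measure_display) (Th : measurableType d)
  (T : measurableType dT) (Pi : probability Th R) (Q : probability T R).
Context (A : set Th) (mA : measurable A).

Lemma measurable_integral_mixture (dS : measure_display) (S : measurableType dS)
    (g : Th * S -> R) :
  measurable_fun setT g -> (forall z, 0 <= g z) ->
  measurable_fun setT (fun s => \int[Pi]_(f in A) (g (f, s))%:E)%E.
Proof.
move=> mg g0.
pose k := (EFin \o g) \_ (A `*` [set: S]).
have mk : measurable_fun setT k.
  apply/(measurable_restrictT _ _).1; first exact: measurableX.
  by apply: measurable_funTS; exact/measurable_EFinP.
have k0 z : (0 <= k z)%E by apply: erestrict_ge0 => u _; rewrite lee_fin.
have := measurable_fun_fubini_tonelli_G (m1 := Pi) k mk k0.
congr (measurable_fun _ _); apply/funext => s; rewrite /fubini_G [RHS]integral_mkcond.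
apply: eq_integral => f _; rewrite /k !patchE.
by congr (if _ then _ else _); apply/idP/idP => /set_mem h; apply/mem_set => //; case: h.
Qed.

(** Tonelli exchanges sample and prior; for fixed [f] in [A] the inner integral factorizes over the
    observations. *)
Lemma integral_mixture_le (n : nat) (g : Th * T -> R) (m : R) :
  measurable_fun setT g -> (forall z, 0 <= g z) -> 0 <= m ->
  (forall f, A f -> (\int[Q]_x (g (f, x))%:E <= m%:E)%E) ->
  (\int[product_law Q n]_s \int[Pi]_(f in A) (\prod_(i < n) g (f, tnth s i))%:E <=
   Pi A * (m ^+ n)%:E)%E.
Proof.
move=> mg g0 m0 gm.
pose G (z : Th * n.-tuple T) := \prod_(i < n) g (z.1, tnth z.2 i).
have mG : measurable_fun setT G.
  apply: measurable_prod => i _; apply: measurableT_comp => //.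
  apply: measurable_fun_pair => //.
  exact: (measurableT_comp (measurable_tnth i) measurable_snd).
have G0 z : 0 <= G z by apply: prodr_ge0.
(* Extension by zero outside [A] permits Tonelli on the whole product, while the bound [gm] is
   available on [A] only. *)
pose k := (EFin \o G) \_ (A `*` [set: n.-tuple T]).
have mk : measurable_fun setT k.
  apply/(measurable_restrictT _ _).1; first exact: measurableX.
  by apply: measurable_funTS; exact/measurable_EFinP.
have k0 z : (0 <= k z)%E by apply: erestrict_ge0 => u _; rewrite lee_fin.
have kE f s : k (f, s) = ((fun f => (G (f, s))%:E) \_ A) f.
  rewrite /k !patchE.
  by congr (if _ then _ else _); apply/idP/idP => /set_mem h; apply/mem_set => //; case: h.
rewrite (eq_integral (fun s => \int[Pi]_f k (f, s))%E); last first.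
  by move=> s _; rewrite [LHS]integral_mkcond; apply: eq_integral => f _; rewrite kE.
rewrite -(fubini_tonelli (m1 := Pi) (m2 := product_law Q n) k mk k0).
apply: (@le_trans _ _ (\int[Pi]_(f in A) (m ^+ n)%:E)%E); last first.
  by rewrite (integral_cst Pi mA) muleC.
rewrite [leRHS]integral_mkcond; apply: le_ge0_integral => f.
  exact: integral_ge0.
rewrite patchE; under eq_integral do rewrite kE patchE; case: ifPn => fA.
  apply: (@integral_product_law_prod_le _ _ _ Q (fun x => g (f, x))) => //.
    exact: measurableT_comp.
  exact/gm/set_mem.
by rewrite integral0.
Qed.

End mixture.

Section expected_posterior.
Context (R : realType) (d dT : measure_display) (Th : measurableType d)
  (T : measurableType dT) (Pi : probability Th R)
  (Q : probability (T * R)%type R) (fs : T -> R) (ph : Th -> T -> R).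
Context (mfs : measurable_fun setT fs)
  (mph : measurable_fun setT (fun z : Th * T => ph z.1 z.2)).

(** Parameters are points of a measurable space [Th], read as regression functions through the
    jointly measurable [ph]; this is what makes Tonelli applicable to prior and sample. *)
Definition sum_llr (n : nat) (f : Th) (s : n.-tuple (T * R)) : R :=
  \sum_(i < n) llr fs (ph f) (tnth s i).

Lemma measurable_llr_uncurried :
  measurable_fun setT (fun z : Th * (T * R) => llr fs (ph z.1) z.2).
Proof.
have mx : measurable_fun setT (fun z : Th * (T * R) => z.2.1).
  exact: (measurableT_comp measurable_fst measurable_snd).
have my : measurable_fun setT (fun z : Th * (T * R) => z.2.2).
  exact: (measurableT_comp measurable_snd measurable_snd).
have mp : measurable_fun setT (fun z : Th * (T * R) => ph z.1 z.2.1).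
  apply: (measurableT_comp (f := fun z : Th * T => ph z.1 z.2)
    (g := fun z : Th * (T * R) => (z.1, z.2.1))) => //.
  exact: measurable_fun_pair.
have mf : measurable_fun setT (fun z : Th * (T * R) => fs z.2.1).
  exact: (measurableT_comp mfs mx).
have mh : measurable_fun setT (fun z : Th * (T * R) => ph z.1 z.2.1 - fs z.2.1).
  exact: measurable_funB.
apply: measurable_funB; first by apply: measurable_funM => //; exact: measurable_funB.
by apply: measurable_funM => //; exact: measurable_funX.
Qed.

Lemma measurable_llr_section (f : Th) : measurable_fun setT (llr fs (ph f)).
Proof. exact: measurable_fun_pair2 measurable_llr_uncurried. Qed.

Lemma measurable_sum_llr (n : nat) :
  measurable_fun setT (fun z : Th * n.-tuple (T * R) => sum_llr z.1 z.2).
Proof.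
apply: measurable_sum => i.
apply: (measurableT_comp (f := fun z : Th * (T * R) => llr fs (ph z.1) z.2)
    (g := fun z : Th * n.-tuple (T * R) => (z.1, tnth z.2 i))).
  exact: measurable_llr_uncurried.
apply: measurable_fun_pair => //.
exact: (measurableT_comp (measurable_tnth i) measurable_snd).
Qed.

Lemma measurable_sum_llr1 (n : nat) (s : n.-tuple (T * R)) :
  measurable_fun setT (fun f => sum_llr f s).
Proof. exact: measurable_fun_pair1 (@measurable_sum_llr n). Qed.

Lemma measurable_sum_llr2 (n : nat) (f : Th) :
  measurable_fun setT (fun s : n.-tuple (T * R) => sum_llr f s).
Proof. exact: measurable_fun_pair2 (@measurable_sum_llr n). Qed.

(* As h r - h^2/2 <= r^2/2, the likelihood ratio is bounded in the regression
   function once the sample is fixed. *)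
Lemma sum_llr_le (n : nat) (f : Th) (s : n.-tuple (T * R)) :
  sum_llr f s <= \sum_(i < n) ((tnth s i).2 - fs (tnth s i).1) ^+ 2 / 2.
Proof.
apply: ler_sum => i _; rewrite /llr.
have := sqr_ge0 (((tnth s i).2 - fs (tnth s i).1) -
                 (ph f (tnth s i).1 - fs (tnth s i).1)).
by rewrite !expr2; lra.
Qed.

Lemma integrable_expR_sum_llr (n : nat) (s : n.-tuple (T * R)) (F : set Th) :
  measurable F -> Pi.-integrable F (fun f => (expR (sum_llr f s))%:E).
Proof.
move=> mF; apply: (integrableS measurableT mF) => //.
apply: (@bounded_integrable _ _ _ Pi _
  (expR (\sum_(i < n) ((tnth s i).2 - fs (tnth s i).1) ^+ 2 / 2))).
  by apply: measurableT_comp => //; exact: measurable_sum_llr1.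
by move=> f; rewrite ger0_norm ?expR_ge0// ler_expR sum_llr_le.
Qed.

(** The expectation of [posterior_le], term by term. The numbers [u0] and [u1] are logarithmic
    moment bounds for one observation, on the prior ball and on the cells, and they enter multiplied
    by [n]. *)
Lemma expected_posterior_le (F B B0 : set Th) (J : seq Th) (A : Th -> set Th)
    (p t alpha u0 u1 : R) (n : nat) :
  measurable F -> measurable B -> measurable B0 -> (forall j, measurable (A j)) ->
  B `<=` F -> B0 `<=` F -> (forall j, A j `<=` F) ->
  (forall f, B f -> exists2 j, j \in J & A j f) ->
  Pi B0 = p%:E -> 0 < p -> 0 <= alpha <= 1 ->
  (forall f, B0 f ->
    \int[Q]_z (expR (- llr fs (ph f) z))%:E <= (expR u0)%:E)%E ->
  (forall j, j \in J ->
    \int[Q]_z (expR (alpha * llr fs (ph j) z))%:E <= (expR u1)%:E)%E ->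
  (forall j f, j \in J -> A j f ->
    \int[Q]_z (expR (llr fs (ph f) z - (1 - alpha) * llr fs (ph j) z))%:E <=
    (expR u1)%:E)%E ->
  (\int[product_law Q n]_s ((\int[Pi]_(f in B) expR (sum_llr f s)) /
     (\int[Pi]_(f in F) expR (sum_llr f s)))%:E <=
   (expR (n%:R * u0 - t) / p +
    (size J)%:R * (2 * expR (alpha * t + n%:R * u1)))%:E)%E.
Proof.
move=> mF mB mB0 mA BF B0F AF BA pE p0 a01 H0 H1 H2.
pose I0 (s : n.-tuple (T * R)) := (\int[Pi]_(f in B0) (expR (- sum_llr f s))%:E)%E.
pose E1 j (s : n.-tuple (T * R)) := (expR (alpha * sum_llr j s))%:E.
pose I2 j (s : n.-tuple (T * R)) :=
  (\int[Pi]_(f in A j) (expR (sum_llr f s - (1 - alpha) * sum_llr j s))%:E)%E.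
have expR_ge0E x : (0 <= (expR x)%:E)%E by rewrite lee_fin expR_ge0.
have mI0 : measurable_fun setT I0.
  apply: (measurable_integral_mixture Pi mB0
    (g := fun z => expR (- sum_llr z.1 z.2))) => [|z]; last exact: expR_ge0.
  by do 2!apply: measurableT_comp => //; exact: measurable_sum_llr.
have mE1 j : measurable_fun setT (E1 j).
  apply/measurable_EFinP; apply: measurableT_comp => //.
  by apply: measurable_funM => //; exact: measurable_sum_llr2.
have mI2 j : measurable_fun setT (I2 j).
  apply: (measurable_integral_mixture Pi (mA j)
    (g := fun z => expR (sum_llr z.1 z.2 - (1 - alpha) * sum_llr j z.2))) => [|z];
    last exact: expR_ge0.
  apply: measurableT_comp => //; apply: measurable_funB.
    exact: measurable_sum_llr.
  apply: measurable_funM => //.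
  exact: (measurableT_comp (measurable_sum_llr2 (n := n) j) measurable_snd).
have I0_ge0 s : (0 <= I0 s)%E by apply: integral_ge0 => f _; exact: expR_ge0E.
have I2_ge0 j s : (0 <= I2 j s)%E by apply: integral_ge0 => f _; exact: expR_ge0E.
have c0 : (0 <= (expR (- t) / p ^+ 2)%:E)%E.
  by rewrite lee_fin divr_ge0 ?expR_ge0 ?exprn_ge0// ltW.
have mE12 j : measurable_fun setT (fun s => (E1 j s + I2 j s)%E).
  exact: emeasurable_funD.
have E12_ge0 j s : (0 <= E1 j s + I2 j s)%E.
  by apply: adde_ge0 => //; exact: expR_ge0E.
apply: (@le_trans _ _ (\int[product_law Q n]_s
    ((expR (- t) / p ^+ 2)%:E * I0 s +
     \sum_(j <- J) (expR (alpha * t))%:E * (E1 j s + I2 j s)))%E).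
  apply: le_ge0_integral => s.
    by rewrite lee_fin divr_ge0//; apply: Rintegral_ge0 => f _; exact: expR_ge0.
  apply: posterior_le => //; last exact: integrable_expR_sum_llr.
  exact: measurable_funTS (measurable_sum_llr1 s).
rewrite ge0_integralD//; first last.
- by apply: emeasurable_sum => j; exact: measurable_funeM.
- by move=> s _; apply: sume_ge0 => j _; apply: mule_ge0; rewrite ?expR_ge0E.
- exact: measurable_funeM.
- by move=> s _; exact: mule_ge0.
rewrite ge0_integralZl// ge0_integral_sum//; first last.
- by move=> j s _; apply: mule_ge0; rewrite ?expR_ge0E.
- by move=> j; exact: measurable_funeM.
rewrite EFinD; apply: leeD.
  (* Integrating over the prior ball returns its mass [p], which cancels one of the two factors [p]
     in the denominator. *)
  apply: (@le_trans _ _ ((expR (- t) / p ^+ 2)%:E * (p%:E * (expR u0 ^+ n)%:E))%E).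
    apply: lee_wpmul2l => //; rewrite -pE.
    rewrite (eq_integral (fun s : n.-tuple (T * R) => \int[Pi]_(f in B0)
        (\prod_(i < n) expR (- llr fs (ph f) (tnth s i)))%:E)%E); last first.
      move=> s _; apply: eq_integral => f _.
      by rewrite /sum_llr -sumrN expR_sum.
    apply: (@integral_mixture_le _ _ _ _ _ Pi Q _ mB0 n
      (fun z => expR (- llr fs (ph z.1) z.2))).
    + by do 2!apply: measurableT_comp => //; exact: measurable_llr_uncurried.
    + by move=> z; exact: expR_ge0.
    + exact: expR_ge0.
    + exact: H0.
  rewrite -!EFinM lee_fin -expRM_natl addrC expRD.
  by rewrite le_eqVlt; apply/orP; left; apply/eqP; field; rewrite gt_eqF.
rewrite (_ : (size J)%:R * _ = \sum_(j <- J) (2 * expR (alpha * t + n%:R * u1))); last first.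
  by rewrite big_const_seq count_predT iter_addr_0 mulr_natl.
rewrite -sumEFin big_seq [leRHS]big_seq; apply: lee_sum => j jJ.
rewrite ge0_integralZl//.
rewrite expRD mulrCA EFinM; apply: lee_wpmul2l; first exact: expR_ge0E.
rewrite ge0_integralD//; last by move=> s _; exact: expR_ge0E.
(* The factor 2 covers the center term and the cell integral, each at most [expR u1 ^+ n]; for the
   latter, the prior mass of the cell is at most one. *)
rewrite expRM_natl mulr_natl mulr2n EFinD; apply: leeD.
  rewrite (eq_integral (fun s : n.-tuple (T * R) =>
      (\prod_(i < n) expR (alpha * llr fs (ph j) (tnth s i)))%:E)); last first.
    by move=> s _; rewrite /E1 /sum_llr mulr_sumr expR_sum.
  apply: (@integral_product_law_prod_le _ _ _ Q
    (fun z => expR (alpha * llr fs (ph j) z))).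
  + apply: measurableT_comp => //; apply: measurable_funM => //.
    exact: measurable_llr_section.
  + by move=> z; exact: expR_ge0.
  + exact: H1.
apply: (@le_trans _ _ (Pi (A j) * (expR u1 ^+ n)%:E)%E).
  rewrite (eq_integral (fun s : n.-tuple (T * R) => \int[Pi]_(f in A j)
      (\prod_(i < n) expR (llr fs (ph f) (tnth s i) -
         (1 - alpha) * llr fs (ph j) (tnth s i)))%:E)%E); last first.
    move=> s _; apply: eq_integral => f _.
    by rewrite /sum_llr mulr_sumr -sumrB expR_sum.
  apply: (@integral_mixture_le _ _ _ _ _ Pi Q _ (mA j) n
    (fun z => expR (llr fs (ph z.1) z.2 - (1 - alpha) * llr fs (ph j) z.2))).
  + apply: measurableT_comp => //; apply: measurable_funB.
      exact: measurable_llr_uncurried.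
    apply: measurable_funM => //.
    exact: (measurableT_comp (measurable_llr_section j) measurable_snd).
  + by move=> z; exact: expR_ge0.
  + exact: expR_ge0.
  + by move=> f Af; exact: H2.
rewrite -[leRHS]mul1e; apply: lee_wpmul2r; first by rewrite lee_fin exprn_ge0 ?expR_ge0.
exact: probability_le1.
Qed.

End expected_posterior.

(** * Covering numbers and the theorem *)

Section covering_centers.
Context (R : realType) (d : measure_display) (T : measurableType d)
  (Q : probability (T * R)%type R).

Lemma normX_lt_integral (g : T -> R) (e : R) :
  (normX Q g < e%:E)%E -> (\int[Q]_z ((g z.1) ^+ 2)%:E <= (e ^+ 2)%:E)%E.
Proof.
rewrite /normX => ge.
have -> : (\int[Q]_z ((g z.1) ^+ 2)%:E =
    'N[Q]_2%:E[(fun z => (g z.1)%:E)] `^ 2)%E.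
  rewrite poweR_Lnorm//; apply: eq_integral => z _.
  by rewrite /= powR_mulrn// real_normK// num_real.
move: (Lnorm_ge0 Q 2%:E (fun z => (g z.1)%:E)) ge.
case: ('N[Q]_2%:E[(fun z => (g z.1)%:E)])%E => [r||]//=.
rewrite lee_fin lte_fin => r0 re; rewrite lee_fin powR_mulrn//.
by rewrite lerXn2r ?nnegrE// ltW// (le_lt_trans r0).
Qed.

(** The moment estimates require centers that lie in [F] and far from [fs], so every ball meeting
    [B] is recentered at a member of [B]. This doubles the radius, whence [4 * e ^+ 2]. The [1]
    added to [N] gives a strict inequality, from which an actual cover is extracted. *)
Lemma exists_covering_centers (F B : set (T -> R)) (e N : R) :
  (forall f, F f -> measurable_fun setT f) -> B `<=` F ->
  (covering_number Q e F <= N%:E)%E ->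
  exists J : seq (T -> R), [/\ (size J)%:R <= N + 1, forall j, j \in J -> B j &
    forall f, B f -> exists2 j, j \in J &
      (\int[Q]_z ((f z.1 - j z.1) ^+ 2)%:E <= (4 * e ^+ 2)%:E)%E].
Proof.
move=> mF BF FN.
have : (covering_number Q e F < (N + 1)%:E)%E.
  by apply: le_lt_trans FN _; rewrite lte_fin ltrDl.
move=> /ereal_inf_lt[_ [k [c [mc cF]] <-]]; rewrite lte_fin => kN.
pose near_c i : set (T -> R) :=
  [set f | B f /\ (normX Q (fun x => f x - c i x)%R < e%:E)%E].
(* Balls that miss [B] are discarded, so the default of [xget] never occurs. *)
pose J := [seq xget point (near_c i) | i <- enum 'I_k & `[< near_c i !=set0 >]].
have nearJ i : near_c i !=set0 -> near_c i (xget point (near_c i)).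
  exact: (xgetPex point).
exists J; split.
- apply: le_trans (ltW kN); rewrite ler_nat size_map size_filter.
  by apply: leq_trans (count_size _ _) _; rewrite size_enum_ord.
- move=> j /mapP[i]; rewrite mem_filter => /andP[/asboolP /nearJ[Bj _] _] ->.
  exact: Bj.
move=> f Bf; have [i fi] := cF f (BF _ Bf).
have ci : near_c i !=set0 by exists f.
exists (xget point (near_c i)).
  by apply/mapP; exists i => //; rewrite mem_filter mem_enum andbT; apply/asboolP.
have [Bj ji] := nearJ i ci; move: Bj ji; move: (xget _ _) => j Bj ji.
have mfc (g : T -> R) : measurable_fun setT g ->
    measurable_fun setT (fun z : T * R => (2 * (g z.1 - c i z.1) ^+ 2)%:E).
  move=> mg; apply/measurable_EFinP; apply: measurable_funM => //.
  apply: measurable_funX; apply: measurable_funB; first exact: measurableT_comp.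
  by apply: (measurableT_comp _ measurable_fst); have [] := mc i.
have ge0E (g : T -> R) (z : T * R) : (0 <= (2 * (g z.1 - c i z.1) ^+ 2)%:E)%E.
  by rewrite lee_fin mulr_ge0// sqr_ge0.
apply: (@le_trans _ _ (\int[Q]_z ((2 * (f z.1 - c i z.1) ^+ 2)%:E +
    (2 * (j z.1 - c i z.1) ^+ 2)%:E))%E).
  apply: le_ge0_integral => z; rewrite lee_fin ?sqr_ge0//.
  have := sqr_ge0 ((f z.1 - c i z.1) + (j z.1 - c i z.1)).
  by rewrite !expr2; lra.
have mf := mF _ (BF _ Bf); have mj := mF _ (BF _ Bj).
rewrite ge0_integralD//; [|exact: mfc|exact: mfc].
have i2 (g : T -> R) : measurable_fun setT g ->
    (normX Q (fun x => g x - c i x)%R < e%:E)%E ->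
    (\int[Q]_z (2 * (g z.1 - c i z.1) ^+ 2)%:E <= (2 * e ^+ 2)%:E)%E.
  move=> mg ge; apply: (@le_trans _ _
      (2%:E * \int[Q]_z ((g z.1 - c i z.1) ^+ 2)%:E)%E).
    rewrite -ge0_integralZl//.
    - apply/measurable_EFinP; apply: measurable_funX.
      apply: measurable_funB; first exact: measurableT_comp.
      by apply: (measurableT_comp _ measurable_fst); have [] := mc i.
    - by move=> z _; rewrite lee_fin sqr_ge0.
  by rewrite EFinM lee_wpmul2l// (normX_lt_integral ge).
apply: le_trans (leeD (i2 _ mf fi) (i2 _ mj ji)) _.
by rewrite -EFinD lee_fin; lra.
Qed.

End covering_centers.

(** Young's inequality, from [delta^-1 * (delta * a + b) ^+ 2 >= 0] with [a = g - h] and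
    [b = f - g]. It transfers the distance of a center from [fs] to the members of its cell, at a
    small relative loss. *)
Lemma sqdist_diff_le (R : realType) (d : measure_display) (T : measurableType d)
    (mu : probability T R) (f g h : T -> R) (k delta : R) :
  measurable_fun setT f -> measurable_fun setT g -> measurable_fun setT h ->
  (forall x, `|f x| <= k) -> (forall x, `|g x| <= k) -> (forall x, `|h x| <= k) ->
  0 < delta ->
  sqdist mu g h - sqdist mu f h <=
    delta * sqdist mu g h + delta^-1 * sqdist mu f g.
Proof.
move=> mf mg mh fk gk hk d0.
have igh := sqdist_integrable mu mg mh gk hk.
have ifh := sqdist_integrable mu mf mh fk hk.
have ifg := sqdist_integrable mu mf mg fk gk.
have i1 := integrableZl measurableT delta igh.
have i2 := integrableZl measurableT delta^-1 ifg.
rewrite /sqdist -RintegralB// -!RintegralZl// -RintegralD//.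
apply: le_Rintegral => //.
- exact: (integrableB measurableT igh ifh).
- exact: (integrableD measurableT i1 i2).
move=> x _.
set a := g x - h x; set b := f x - g x.
have -> : f x - h x = a + b by rewrite /a /b; ring.
have s0 : 0 <= delta^-1 * (delta * a + b) ^+ 2.
  by rewrite mulr_ge0 ?sqr_ge0 ?invr_ge0 ?ltW.
have e0 : delta^-1 * (delta * a + b) ^+ 2 =
   delta * a ^+ 2 + 2 * (a * b) + delta^-1 * b ^+ 2.
  by field; rewrite gt_eqF.
have b0 := sqr_ge0 b.
rewrite e0 in s0.
have e1 : (a + b) ^+ 2 = a ^+ 2 + 2 * (a * b) + b ^+ 2 by ring.
by rewrite e1; lra.
Qed.

Lemma meanX_distribution (R : realType) (dW dT : measure_display)
    (W : measurableType dW) (T : measurableType dT) (P : probability W R)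
    (X : {RV P >-> T}) (XY : {RV P >-> (T * R)%type}) (g : T -> R) (k : R) :
  (forall w, (XY w).1 = X w) -> measurable_fun setT g -> (forall x, `|g x| <= k) ->
  meanX (distribution P XY) g = (\int[distribution P X]_x g x)%:E.
Proof.
move=> XYX mg gk; rewrite /meanX unlock.
have mgE : measurable_fun setT (fun x => (g x)%:E) by exact/measurable_EFinP.
have mgE1 : measurable_fun setT (fun z : T * R => (g z.1)%:E).
  exact: (measurableT_comp mgE measurable_fst).
have igX : P.-integrable setT (EFin \o (g \o X)).
  apply: (@bounded_integrable _ _ _ P _ k); first exact: measurableT_comp.
  by move=> w; exact: gk.
rewrite -(EFin_Rintegral (bounded_integrable (distribution P X) mg gk)).
rewrite (integral_distribution mgE igX).
have XYE : (fun z : T * R => (g z.1)%:E) \o XY = EFin \o (g \o X).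
  by apply/funext => w /=; rewrite XYX.
by rewrite (integral_distribution mgE1) XYE.
Qed.

Lemma likelihood_sum_llr (R : realType) (d : measure_display)
    (T : measurableType d) (d' : measure_display) (Th : measurableType d') (ph : Th -> T -> R) (fs : T -> R)
    (n : nat) (s : n.-tuple (T * R)) (f : Th) :
  likelihood s (ph f) = likelihood s fs * expR (sum_llr fs ph f s).
Proof.
rewrite /likelihood /sum_llr expR_sum -big_split /=.
by apply: eq_bigr => i _; exact: normal_pdf_llr.
Qed.

Lemma likelihood_gt0 (R : realType) (d : measure_display) (T : measurableType d)
    (fs : T -> R) (n : nat) (s : n.-tuple (T * R)) : 0 < likelihood s fs.
Proof.
apply: prodr_gt0 => i _; rewrite normal_pdfE ?oner_eq0//.
by rewrite mulr_gt0 ?expR_gt0 ?normal_peak_gt0 ?oner_eq0.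
Qed.

(** * Choice of the constants and convergence of the expected posterior mass *)

Theorem theorem4p1 (R : realType)
  (dW dT : measure_display) (W : measurableType dW) (T : measurableType dT)
  (P : probability W R) (X : {RV P >-> T}) (e0 : {RV P >-> R})
  (f0 : T -> R) (XY : {RV P >-> (T * R)%type})
  (mf0 : measurable_fun setT f0)
  (XYE : forall w, XY w = (X w, f0 (X w) + e0 w))
  (indep : independent_RVs X e0)
  (P0 : probability (T * R)%type R) (P0E : P0 = distribution P XY)
  (F : set (T -> R)) (G : set (set (T -> R)))
  (Pi : probability (g_sigma_algebraType G) R)
  (mF : measurable (F : set (g_sigma_algebraType G)))
  (PiF : Pi F = 1%E)
  (mev : measurable_fun ((F : set (g_sigma_algebraType G)) `*` [set: T])
           (fun z : g_sigma_algebraType G * T => z.1 z.2))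
  (mfun : forall f, F f -> measurable_fun setT f)
  (bF : exists K : R, forall f x, F f -> `|f x| <= K)
  (alt : F f0 \/ (convex_in_L2 P0 F /\ closed_in_L2 P0 F))
  (bf0 : exists K : R, forall x, `|f0 x| <= K)
  (Ee0 : ('E_P[e0] = 0)%E)
  (expe0 : forall M : R, 0 < M ->
     ('E_P[(fun w => expR (M * `|e0 w|))%R] < +oo)%E)
  (fs : T -> R) (fsmin : is_risk_minimizer P0 F f0 fs)
  (orth : forall f, F f ->
     meanX P0 (fun x => (f x - fs x) * (fs x - f0 x)) = 0%E)
  (eps : nat -> R) (L : R)
  (eps_gt0 : forall n, (0 < n)%N -> 0 < eps n)
  (eps_cvg : eps n @[n --> \oo] --> (0 : R))
  (neps_cvg : (n%:R * eps n ^+ 2 : R) @[n --> \oo] --> +oo)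
  (L_gt0 : 0 < L)
  (prior_mass : forall n, (0 < n)%N ->
     ((expR (- (L * n%:R * eps n ^+ 2)))%:E <=
      Pi [set f | F f /\ meanX P0 (fun x => (f x - fs x) ^+ 2)%R
                           <= (eps n ^+ 2)%:E])%E)
  (entropy : forall n, (0 < n)%N ->
     (covering_number P0 (eps n) F <= (expR (n%:R * eps n ^+ 2))%:E)%E) :
  exists M0 : R, forall M : R, M0 <= M ->
    ('E_(product_law P0 n)[posterior Pi F
       [set f | F f /\ ((M * eps n ^+ 2)%:E <=
                        meanX P0 (fun x => (f x - fs x) ^+ 2)%R)%E] (n := n)])%E
      @[n --> \oo] --> 0%E.
Proof.
pose Th := g_sigma_algebraType G.
pose mu : probability T R := distribution P X.
pose nu : probability R R := distribution P e0.
have [K1 fK] := bF; have [K2 f0K] := bf0.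
pose c : R := `|K1| + `|K2|.
have c_ge0 : 0 <= c by rewrite addr_ge0.
have K1c : K1 <= c by rewrite (le_trans (ler_norm _))// lerDl.
have K2c : K2 <= c by rewrite (le_trans (ler_norm _))// lerDr.
have f0c x : `|f0 x| <= c by exact: le_trans (f0K x) K2c.
have [Ffs _] := fsmin.
have fsc x : `|fs x| <= c by exact: le_trans (fK _ x Ffs) K1c.
have mfs := mfun _ Ffs.
(* Evaluation, extended by 0 outside F to be jointly measurable everywhere. *)
pose ev : Th * T -> R :=
  (fun z => z.1 z.2) \_ ((F : set Th) `*` [set: T]).
pose ph (f : Th) (x : T) : R := ev (f, x).
have phE (f : Th) : F f -> ph f = f.
  by move=> Ff; apply/funext => x; rewrite /ph /ev patchE mem_set.
have mph : measurable_fun setT (fun z : Th * T => ph z.1 z.2).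
  have : measurable_fun setT ev.
    by apply/(measurable_restrictT _ _).1 => //; exact: measurableX.
  by congr (measurable_fun _ _); apply/funext => -[].
have mphf f : measurable_fun setT (ph f) by exact: measurable_fun_pair2 mph.
have phc f x : `|ph f x| <= c.
  rewrite /ph /ev patchE; case: ifPn => [/set_mem[/= Ff _]|_].
    exact: le_trans (fK f x Ff) K1c.
  by rewrite [point](_ : _ = 0)// normr0.
have XYX w : (XY w).1 = X w by rewrite XYE.
have meanXE (g : T -> R) (k : R) : measurable_fun setT g ->
    (forall x, `|g x| <= k) -> meanX P0 g = (\int[mu]_x g x)%:E.
  by rewrite P0E; exact: meanX_distribution.
have sqE (f g : T -> R) : measurable_fun setT f -> measurable_fun setT g ->
    (forall x, `|f x| <= c) -> (forall x, `|g x| <= c) ->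
    meanX P0 (fun x => (f x - g x) ^+ 2) = (sqdist mu f g)%:E.
  move=> mf mg fc gc; apply: (meanXE _ ((c + c) ^+ 2)).
    by apply: measurable_funX; exact: measurable_funB.
  move=> x; rewrite normrX lerXn2r ?nnegrE ?addr_ge0//.
  by apply: le_trans (ler_normB _ _) _; exact: lerD.
have reg (f : T -> R) : F f -> regular_regressor mu f0 fs c f.
  move=> Ff; split; [exact: mfun|by move=> x; exact: le_trans (fK f x Ff) K1c|].
  have := orth _ Ff; rewrite (meanXE _ ((c + c) * (c + c))) => [[]//||x].
    by apply: measurable_funM; apply: measurable_funB => //; exact: mfun.
  rewrite normrM; apply: ler_pM => //; apply: le_trans (ler_normB _ _) _;
    apply: lerD => //; exact: le_trans (fK f x Ff) K1c.
have P0int (H : T * R -> \bar R) : measurable_fun setT H -> (forall z, 0 <= H z)%E ->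
    (\int[P0]_z H z = \int[mu]_x \int[nu]_e H (x, (f0 x + e)%R))%E.
  by rewrite P0E; exact: integral_regression_law.
have nu_exp (M : R) : 0 < M -> (\int[nu]_e (expR (M * `|e|))%:E < +oo)%E.
  move=> M0; have := expe0 _ M0; rewrite unlock.
  rewrite (ge0_integral_distribution e0 (f := fun e => (expR (M * `|e|))%:E)) => [//||e].
    apply/measurable_EFinP; apply: measurableT_comp => //.
    by apply: measurable_funM => //; exact: normr_measurable.
  by rewrite lee_fin expR_ge0.
have nu_mean : (\int[nu]_e e%:E = 0)%E.
  rewrite -Ee0 unlock; apply: (integral_distribution (X := e0) (f := EFin)).
    exact/measurable_EFinP.
  have ie : P.-integrable setT (fun w => (expR (1 * `|e0 w|))%:E).
    apply/integrableP; split.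
      apply/measurable_EFinP; apply: measurableT_comp => //.
      by apply: measurable_funM => //; exact: measurableT_comp.
    under eq_integral do rewrite gee0_abs ?lee_fin ?expR_ge0//.
    by have := expe0 _ ltr01; rewrite unlock.
  apply: (le_integrable measurableT _ _ ie) => [|w _].
    by apply/measurable_EFinP; exact: measurableT_comp.
  rewrite lee_fin mul1r [leRHS]ger0_norm ?expR_ge0//=.
  by apply: le_trans (expR_ge1Dx _); rewrite lerDr.
have [kappa kappa0 mgf] := llr_mgf_le c_ge0 mf0 mfs f0c fsc P0int nu_exp nu_mean.
(* Then [kappa * alpha <= 1 / 8], so the error [kappa * alpha ^+ 2] is at most [alpha / 8] and is
   absorbed by the gain [alpha / 2]. *)
pose alpha := (8 * kappa + 1)^-1.
have kap1 : 1 <= 8 * kappa + 1 by lra.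
have alpha0 : 0 < alpha by rewrite invr_gt0; lra.
have alpha1 : alpha <= 1 by rewrite invf_le1//; lra.
have kalpha : kappa * alpha <= 1 / 8.
  by rewrite /alpha ler_pdivrMr; lra.
(* The evidence threshold is [expR (- t)] with [t = C0 * ne]: [L] pays for the prior mass,
   [kappa + 1 / 2] for the moment on the prior ball, and a surplus of 1 gives the decay. *)
pose C0 := L + kappa + 3 / 2.
pose C1 := 4 * (kappa + alpha^-1).
(* Chosen so that [alpha * M / 8] beats the threshold term [alpha * C0], the cell radius term [C1],
   the entropy (1) and the wanted decay (1). *)
exists (8 / alpha * (2 + alpha * C0 + C1)) => M ML.
have MC : 2 + alpha * C0 + C1 <= alpha * M / 8.
  have -> : 2 + alpha * C0 + C1 =
      alpha / 8 * (8 / alpha * (2 + alpha * C0 + C1)).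
    by field; rewrite gt_eqF.
  have := ler_wpM2l (ltW alpha0) ML; lra.
(* The sets are rewritten with [sqdist] and [ph], so that their measurability follows from that of
   [f |-> sqdist mu (ph f) g] on all of [Th]. The cells [A] have the doubled covering radius. *)
pose B n : set Th := F `&`
  [set f : Th | ((M * eps n ^+ 2)%:E <= (sqdist mu (ph f) fs)%:E)%E].
pose B0 n : set Th := F `&`
  [set f : Th | ((sqdist mu (ph f) fs)%:E <= (eps n ^+ 2)%:E)%E].
pose A n (j : Th) : set Th := F `&`
  [set f : Th | ((sqdist mu (ph f) (ph j))%:E <= (4 * eps n ^+ 2)%:E)%E].
have BE n : [set f | F f /\ ((M * eps n ^+ 2)%:E <=
    meanX P0 (fun x => (f x - fs x) ^+ 2)%R)%E] = B n.
  by apply/seteqP; split=> f [Ff h]; split=> //; move: h => /=;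
    rewrite -(sqE (ph f) fs)// phE.
have B0E n : [set f | F f /\ (meanX P0 (fun x => (f x - fs x) ^+ 2)%R <=
    (eps n ^+ 2)%:E)%E] = B0 n.
  by apply/seteqP; split=> f [Ff h]; split=> //; move: h => /=;
    rewrite -(sqE (ph f) fs)// phE.
have msq (g : T -> R) : measurable_fun setT g -> (forall x, `|g x| <= c) ->
    measurable_fun setT (fun f : Th => (sqdist mu (ph f) g)%:E).
  move=> mg gc.
  have mh : measurable_fun setT (fun z : Th * T => ((ph z.1 z.2 - g z.2) ^+ 2)%:E).
    apply/measurable_EFinP; apply: measurable_funX; apply: measurable_funB => //.
    exact: (measurableT_comp mg measurable_snd).
  have h0 (z : Th * T) : (0 <= ((ph z.1 z.2 - g z.2) ^+ 2)%:E)%E.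
    by rewrite lee_fin sqr_ge0.
  have := @measurable_fun_fubini_tonelli_F _ _ _ _ _ mu _ mh h0.
  congr (measurable_fun _ _); apply/funext => f; rewrite /fubini_F /=.
  exact: (EFin_sqdist mu (mphf f) mg (phc f) gc).
have mB n : measurable (B n).
  by apply: emeasurable_fun_c_infty => //; exact: measurable_funTS (msq _ mfs fsc).
have mB0 n : measurable (B0 n).
  by apply: emeasurable_fun_infty_c => //; exact: measurable_funTS (msq _ mfs fsc).
have mA n j : measurable (A n j).
  by apply: emeasurable_fun_infty_c => //; exact: measurable_funTS (msq _ (mphf j) (phc j)).
(* The 5 is 1 for small evidence plus 4 for the cells: a factor 2 from their number and a factor 2
   from the two terms of each cell. *)
have bound n : (0 < n)%N ->
    ('E_(product_law P0 n)[posterior Pi F (B n) (n := n)] <=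
     (5 * expR (- (n%:R * eps n ^+ 2)))%:E)%E.
  move=> n0; set e2 := eps n ^+ 2; set ne := n%:R * e2.
  have e20 : 0 < e2 by rewrite exprn_gt0// eps_gt0.
  have ne0 : 0 < ne by rewrite mulr_gt0// ltr0n.
  have [p pE] : exists p : R, Pi (B0 n) = p%:E.
    by exists (fine (Pi (B0 n))); rewrite fineK// fin_num_measure.
  have pge : expR (- (L * ne)) <= p.
    by rewrite /ne mulrA -lee_fin -pE -B0E; exact: prior_mass.
  have p0 : 0 < p by exact: lt_le_trans (expR_gt0 _) pge.
  have [J [sJ JB coverJ]] :=
    exists_covering_centers mfun (fun f (Bf : B n f) => Bf.1) (entropy _ n0).
  pose t := C0 * ne; pose u0 := (kappa + 1 / 2) * e2.
  pose u1 := (C1 - alpha * M / 8) * e2.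
  have H0 f : B0 n f -> (\int[P0]_z (expR (- llr fs (ph f) z))%:E <= (expR u0)%:E)%E.
    move=> [Ff]; rewrite /= lee_fin phE// -/e2 => fe.
    have := mgf fs f 0 (reg _ Ffs) (reg _ Ff).
    rewrite lexx ler01 => /(_ isT).
    under eq_integral do rewrite llr_xx subr0 mul1r sub0r.
    move=> /le_trans; apply; rewrite lee_fin; apply: le_trans (expR_ge1Dx _).
    rewrite sqdist_xx (sqdistC mu fs f) expr0n /= /u0.
    have := ler_wpM2l (ltW kappa0) fe; lra.
  have H2 j f : j \in J -> A n j f ->
      (\int[P0]_z (expR (llr fs (ph f) z - (1 - alpha) * llr fs (ph j) z))%:E <=
       (expR u1)%:E)%E.
    move=> /JB[Fj]; rewrite /= lee_fin phE// -/e2 => sj [Ff].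
    rewrite /= lee_fin !phE// -/e2 => fj.
    have := mgf f j alpha (reg _ Ff) (reg _ Fj).
    rewrite (ltW alpha0) alpha1 => /(_ isT) /le_trans; apply.
    rewrite lee_fin; apply: le_trans (expR_ge1Dx _).
    have [mf fc _] := reg _ Ff; have [mj jc _] := reg _ Fj.
    (* With weight [alpha / 2], half of the Young bound costs [alpha / 4] times the squared distance
       of [j] from [fs]; [q2] costs another [alpha / 8], which leaves [alpha / 8] of the gain
       [alpha / 2]. *)
    have a20 : 0 < alpha / 2 by rewrite divr_gt0.
    have := sqdist_diff_le mu mf mj mfs fc jc fsc a20.
    have -> : (alpha / 2)^-1 = 2 * alpha^-1 by rewrite invf_div.
    have q1 := ler_wpM2l (ltW alpha0) sj.
    have q2 : kappa * alpha ^+ 2 * sqdist mu j fs <= alpha / 8 * sqdist mu j fs.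
      rewrite ler_wpM2r ?sqdist_ge0// expr2 mulrA.
      by have := ler_wpM2r (ltW alpha0) kalpha; lra.
    have q3 := ler_wpM2l (ltW kappa0) fj.
    have ai0 : 0 <= alpha^-1 by rewrite invr_ge0 ltW.
    have q4 := ler_wpM2l ai0 fj.
    rewrite /u1 /C1; lra.
  (* This is [H2] at the center itself, where the exponent collapses to
     [alpha * llr fs (ph j) z]. *)
  have H1 j : j \in J ->
      (\int[P0]_z (expR (alpha * llr fs (ph j) z))%:E <= (expR u1)%:E)%E.
    move=> jJ; have [Fj _] := JB j jJ.
    have : A n j j.
      split=> //=; rewrite sqdist_xx lee_fin mulr_ge0//; exact: ltW.
    move=> /(H2 j j jJ); congr (_ <= _)%E; apply: eq_integral => z _.
    by congr (expR _)%:E; ring.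
  have coverA f : B n f -> exists2 j, j \in J & A n j f.
    move=> Bf; have [Ff _] := Bf; have [j jJ fj] := coverJ f Bf.
    exists j => //; split => //=; have [Fj _] := JB j jJ.
    have [mf fc _] := reg _ Ff; have [mj jc _] := reg _ Fj.
    by rewrite !phE// -(sqE f j mf mj fc jc) /meanX unlock.
  (* The likelihood of [fs] is a positive constant for a fixed sample and cancels in the ratio. *)
  have postE (s : n.-tuple (T * R)) : posterior Pi F (B n) s =
      (\int[Pi]_(f in B n) expR (sum_llr fs ph f s)) /
      (\int[Pi]_(f in (F : set Th)) expR (sum_llr fs ph f s)).
    have scale (C : set Th) : measurable C -> C `<=` F ->
        \int[Pi]_(f in C) likelihood s f =
        likelihood s fs * \int[Pi]_(f in C) expR (sum_llr fs ph f s).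
      move=> mC CF; rewrite -RintegralZl//; last exact: integrable_expR_sum_llr.
      apply: eq_Rintegral => f /set_mem /CF Ff.
      by rewrite -likelihood_sum_llr phE.
    rewrite /posterior !scale//; last by move=> f [].
    by rewrite invfM mulrACA divff ?mul1r// gt_eqF// likelihood_gt0.
  rewrite unlock; under eq_integral do rewrite postE.
  apply: le_trans.
    apply: (expected_posterior_le mfs mph (B0 := B0 n) (J := J) (A := A n)
      (p := p) (alpha := alpha) (u0 := u0) (u1 := u1) t n mF (mB n)
      (mB0 n) (mA n)) => //.
    - by move=> f [].
    - by move=> f [].
    - by move=> j f [].
    - by rewrite (ltW alpha0).
  have nu0 : n%:R * u0 - t + L * ne = - ne by rewrite /u0 /t /C0 /ne; field.
  have nu1 : alpha * t + n%:R * u1 + ne <= - ne.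
    have -> : n%:R * u1 = (C1 - alpha * M / 8) * ne by rewrite /u1 /ne; ring.
    rewrite /t; have := ler_wpM2r (ltW ne0) MC; lra.
  have b1 : expR (n%:R * u0 - t) / p <= expR (- ne).
    rewrite ler_pdivrMr// -nu0 [expR (_ + L * ne)]expRD -mulrA ler_peMr ?expR_ge0//.
    have := ler_wpM2l (expR_ge0 (L * ne)) pge.
    by rewrite -expRD subrr expR0.
  have b2 : (size J)%:R * (2 * expR (alpha * t + n%:R * u1)) <= 4 * expR (- ne).
    have ene : 1 <= expR ne by rewrite -[leLHS]expR0 ler_expR ltW.
    (* The additional 1 in the number of centers is absorbed by [1 <= expR ne]. *)
    have sJ2 : (size J)%:R <= 2 * expR ne by apply: le_trans sJ _; lra.
    have := ler_wpM2r (expR_ge0 (alpha * t + n%:R * u1)) sJ2.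
    rewrite -mulrA -expRD [ne + _]addrC.
    have : expR (alpha * t + n%:R * u1 + ne) <= expR (- ne) by rewrite ler_expR.
    lra.
  by rewrite lee_fin; lra.
have post_ge0 n (s : n.-tuple (T * R)) : 0 <= posterior Pi F (B n) s.
  rewrite divr_ge0//; apply: Rintegral_ge0 => f _; exact/ltW/likelihood_gt0.
have lim0 : (5 * expR (- (n%:R * eps n ^+ 2)))%:E @[n --> \oo] --> 0%E.
  apply: cvg_EFin; first exact: nearW.
  rewrite -[X in _ --> X](mulr0 5); apply: cvgMr.
  exact: (cvg_comp _ _ neps_cvg (@cvgr_expR R)).
have squeezed : \forall n \near \oo,
    (0 <= 'E_(product_law P0 n)[posterior Pi F (B n) (n := n)] <=
     (5 * expR (- (n%:R * eps n ^+ 2)))%:E)%E.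
  by exists 1%N => // n n0; rewrite bound// andbT; apply: expectation_ge0.
under eq_cvg do rewrite BE.
exact: (squeeze_cvge squeezed (cvg_cst _) lim0).
Qed.
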